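(* Let $G$ be the incomparability graph of a natural unit interval order on $[n]$. For each partition $\lambda\vdash n$ let $c^G_\lambda(t)$ be the coefficient of $e_\lambda$ in the expansion of $X_G(\mathbf x,t)$ in the elementary symmetric function basis. Then for each $j$, $$\sum_{\lambda\in\mathrm{Par}(n,j)}c^G_\lambda(t)=\sum_{o\in\mathcal O(G,j)}t^{\mathrm{asc}(o)},$$ where $\mathrm{Par}(n,j)$ is the set of partitions of $n$ into exactly $j$ parts, $\mathcal O(G,j)$ is the set of acyclic orientations of $G$ with exactly $j$ sinks, and $\mathrm{asc}(o)$ is the number of directed edges $(i,k)$ of $o$ with $i<k$.
   Context: A natural unit interval order is a poset $P$ on $[n]$ such that (1) $x<_P y$ implies $x<y$ as integers, and (2) whenever the disjoint union of a chain $x<_P z$ and an element $y$ (incomparable to both) is an induced subposet of $P$, then $x<y<z$ as integers. Its incomparability graph has vertex set $[n]$ and edges the pairs of $P$-incomparable elements. For a graph $G$ on $[n]$, a proper coloring is $c:[n]\to\mathbb P$ with $c(i)\ne c(j)$ for $\{i,j\}\in E(G)$; $C(G)$ is the set of proper colorings, $\mathbf x_c=\prod_i x_{c(i)}$, $\mathrm{asc}(c)=|\{\{i,j\}\in E(G):i<j,\ c(i)<c(j)\}|$, and $X_G(\mathbf x,t)=\sum_{c\in C(G)}t^{\mathrm{asc}(c)}\mathbf x_c$, which for such $G$ is a polynomial in $t$ with symmetric function coefficients. *)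

(* Defs.v *)
From HB Require Import structures.
From mathcomp Require Import all_boot all_order all_algebra.
From mathcomp Require Import finmap.
From mathcomp.multinomials Require Export monalg.

Set Implicit Arguments.
Unset Strict Implicit.
Unset Printing Implicit Defensive.

Import GRing.Theory.
Local Open Scope ring_scope.

(** Throughout, [n] = {1, ..., n} is rendered by ['I_n] and the set of positive
    integers (colours, indices of variables) by [nat]: both are shifted by one,
    which preserves the order. *)

(** [P x y] stands for the strict relation x <_P y. *)
Definition incomparable n (P : rel 'I_n) : rel 'I_n :=
  fun x y => [&& x != y, ~~ P x y & ~~ P y x].

Definition natural_unit_interval_order n (P : rel 'I_n) : Prop :=
  [/\ irreflexive P, transitive P,
      forall x y : 'I_n, P x y -> (x < y)%N
    & forall x y z : 'I_n, P x z -> incomparable P y x -> incomparable P y z ->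
        (x < y)%N && (y < z)%N].

(** A formal power series in the variables x_0, x_1, x_2, ... is its
    coefficient function on monomials. *)
Definition fps (R : Type) := {cmonom nat} -> R.

Definition fps_one (R : comNzRingType) : fps R := fun m => (m == mone)%:R.

(** The divisors of the monomial [m] all have this form, for exactly one [k]
    (see [submonP] and [submon_inj]). *)
Definition submon (m : {cmonom nat}) (k : {ffun finsupp m -> 'I_(mdeg m).+1}) :
  {cmonom nat} := [cmonom (k i : nat) | i : finsupp m]%M.

Definition fps_mul (R : comNzRingType) (f g : fps R) : fps R := fun m =>
  \sum_(k : {ffun finsupp m -> 'I_(mdeg m).+1} *
             {ffun finsupp m -> 'I_(mdeg m).+1}
       | mmul (submon k.1) (submon k.2) == m)
     f (submon k.1) * g (submon k.2).

(** e_k is the sum of the squarefree monomials of degree k; e_0 = 1. *)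
Definition fps_esym (R : comNzRingType) (k : nat) : fps R := fun m =>
  ((mdeg m == k) && [forall i : finsupp m, m (val i) == 1%N])%:R.

(** A partition of [n] is padded with zeros to length [n]; its parts are the
    nonzero entries. *)
Definition is_partition n (la : n.-tuple 'I_n.+1) : bool :=
  sorted geq (map val la) && (sumn (map val la) == n).

Definition partition_of n := {la : n.-tuple 'I_n.+1 | is_partition la}.

Definition parts n (la : partition_of n) : seq nat :=
  [seq k <- map val (val la) | 0 < k]%N.

Definition Par n (j : nat) : {set partition_of n} :=
  [set la | size (parts la) == j].

Definition fps_esym_part (R : comNzRingType) n (la : partition_of n) : fps R :=
  \big[@fps_mul R/fps_one R]_(k <- parts la) fps_esym R k.

Definition is_e_expansion (R : comNzRingType) n (f : fps R)
    (c : partition_of n -> R) : Prop :=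
  forall m, f m = \sum_(la : partition_of n) c la * fps_esym_part R la m.

Definition proper_coloring n (G : rel 'I_n) (c : 'I_n -> nat) : bool :=
  [forall i, forall j, G i j ==> (c i != c j)].

Definition asc_coloring n (G : rel 'I_n) (c : 'I_n -> nat) : nat :=
  #|[set p : 'I_n * 'I_n | [&& G p.1 p.2, (p.1 < p.2)%N & (c p.1 < c p.2)%N]]|.

Definition coloring_monomial n (c : 'I_n -> nat) : {cmonom nat} :=
  \big[mmul/mone]_(i < n) ucm (c i).

(** The coefficient of a monomial [m] is the sum of t^asc(c) over the proper
    colourings [c] with x_c = [m]; such a colouring takes its values in the
    support of [m] (see [coloring_monomial_supp]). *)
Definition chromatic_qsym n (G : rel 'I_n) : fps {poly int} := fun m =>
  \sum_(c : {ffun 'I_n -> finsupp m}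
       | proper_coloring G (fun i => val (c i))
         && (coloring_monomial (fun i => val (c i)) == m))
     'X^(asc_coloring G (fun i => val (c i))).

(** Orientations are sets of directed edges, [(x, y)] going from [x] to [y]. *)

Definition arc n (o : {set 'I_n * 'I_n}) : rel 'I_n := fun x y => (x, y) \in o.

Definition is_orientation n (G : rel 'I_n) (o : {set 'I_n * 'I_n}) : bool :=
  [forall x, forall y, if G x y then arc o x y (+) arc o y x else ~~ arc o x y].

Definition acyclic n (o : {set 'I_n * 'I_n}) : bool :=
  [forall x, forall y, arc o x y ==> ~~ connect (arc o) y x].

Definition sinks n (o : {set 'I_n * 'I_n}) : {set 'I_n} :=
  [set x | [forall y, ~~ arc o x y]].

Definition acyclic_orientations n (G : rel 'I_n) (j : nat) :
    {set {set 'I_n * 'I_n}} :=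
  [set o | [&& is_orientation G o, acyclic o & #|sinks o| == j]].

Definition asc_orientation n (o : {set 'I_n * 'I_n}) : nat :=
  #|[set p in o | (p.1 < p.2)%N]|.

Lemma submonE (m : {cmonom nat}) (k : {ffun finsupp m -> 'I_(mdeg m).+1}) i :
  submon k i = if insub i is Some u then k u : nat else 0%N.
Proof. by rewrite /submon cmE /= fsfun_ffun; case: insubP. Qed.

Lemma submon_inj (m : {cmonom nat}) : injective (@submon m).
Proof.
move=> k1 k2 eqk; apply/ffunP => u; apply: val_inj.
have := congr1 (fun m' : {cmonom nat} => m' (val u)) eqk.
by rewrite /= !submonE valK.
Qed.

Lemma submonP (m m1 m2 : {cmonom nat}) :
  mmul m1 m2 = m -> exists k : {ffun finsupp m -> 'I_(mdeg m).+1}, submon k = m1.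
Proof.
move=> def_m; have le_m i : (m1 i <= m i)%N by rewrite -def_m cmM leq_addr.
have le_deg i : (m i <= mdeg m)%N.
  case: (mdomP m i) => // mi; rewrite mdegE.
  by rewrite (big_fsetD1 i) //= leq_addr.
exists [ffun u : finsupp m => inord (m1 (val u))]; apply/eqP/cmP => i.
rewrite submonE; case: insubP => [u _ <-|].
  by rewrite ffunE inordK // ltnS (leq_trans (le_m _)).
by rewrite -cmE_eq0 => /eqP mi0; move: (le_m i); rewrite mi0 leqn0 => /eqP->.
Qed.

Lemma coloring_monomial_supp n (c : 'I_n -> nat) (i : 'I_n) :
  c i \in finsupp (coloring_monomial c).
Proof.
by rewrite /coloring_monomial (bigD1 i) //= mdomD in_fsetE mdomU in_fset1 eqxx.
Qed.

(* Main.v *)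
(** Evaluate the e-expansion at [x_0 = ... = x_(N-1) = 1] and [x_N = v]. Both
    sides are polynomials in [N], hence may be compared at [N = -1]. There [e_k]
    becomes [(-1)^k (1 - v)], so [e_la] becomes [(-1)^n (1 - v)^l] where [l] is
    the number of parts of [la]. On the other side the proper colourings are
    grouped by the acyclic orientation [o] pointing to the larger colour; the set
    [S] of vertices of colour [N] is any set of sinks, and the remaining vertices
    contribute their strict order polynomial, whose value at [-1] is
    [(-1)^(n - |S|)]. Summing over [S] gives [(-1)^n (1 - v)^s] for an
    orientation with [s] sinks. Now compare the coefficients of [(1 - v)^j]. *)

From mathcomp Require Import all_boot all_order all_algebra.
From mathcomp Require Import finmap.
From mathcomp Require Import zify ring.
Require Import Defs.

Set Implicit Arguments.
Unset Strict Implicit.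
Unset Printing Implicit Defensive.

Import GRing.Theory.
Local Open Scope ring_scope.

(** * Reindexing along relations, and weighted sums over subsets *)

(** Both sides equal the double sum over related pairs. Describing the bijection by a relation
    avoids composing explicit inverse maps when the two index types are finite functions with
    different domains or codomains. *)
Lemma big_rel_bij (V : Type) (idx : V) (op : Monoid.com_law idx) (I J : finType)
    (P : pred I) (Q : pred J) (r : I -> J -> bool) (F : I -> V) (G : J -> V) :
  (forall i, P i -> exists2 j, Q j & r i j) ->
  (forall j, Q j -> exists2 i, P i & r i j) ->
  (forall i j j', P i -> Q j -> Q j' -> r i j -> r i j' -> j = j') ->
  (forall i i' j, P i -> P i' -> Q j -> r i j -> r i' j -> i = i') ->
  (forall i j, P i -> Q j -> r i j -> F i = G j) ->
  \big[op/idx]_(i | P i) F i = \big[op/idx]_(j | Q j) G j.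
Proof.
move=> exJ exI unJ unI eqFG.
transitivity (\big[op/idx]_(i | P i) \big[op/idx]_(j | Q j && r i j) F i).
  apply: eq_bigr => i Pi; have [j Qj rij] := exJ i Pi.
  rewrite (big_pred1 j) // => j' /=; apply/andP/eqP => [[Qj' rij']|-> //].
  exact: (unJ i).
rewrite (exchange_big_dep Q) /=; last by move=> i j _ /andP[].
apply: eq_bigr => j Qj; have [i Pi rij] := exI j Qj.
rewrite (big_pred1 i) => [|i' /=]; first exact: eqFG.
by apply/and3P/eqP => [[Pi' _ ri'j]|->//]; exact: (unI _ _ j).
Qed.

(** Expand the product over all [i] of [x + 1] for [i] in [A] and [0 + 1] otherwise; choice sets not
    contained in [A] contribute zero. *)
Lemma sum_subset_expr (R : comNzRingType) (T : finType) (A : {set T}) (x : R) :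
  \sum_(S : {set T} | S \subset A) x ^+ #|S| = (1 + x) ^+ #|A|.
Proof.
transitivity (\prod_(i : T) ((if i \in A then x else 0) + 1)).
  rewrite bigA_distr [RHS](bigID (fun S : {set T} => S \subset A)) /= [X in _ + X]big1.
    rewrite addr0; apply: eq_bigr => S sSA.
    rewrite -big_mkcond /= -prodr_const; apply: eq_bigr => i iS.
    by rewrite (subsetP sSA).
  by move=> S /subsetPn[i iS iA]; rewrite (bigD1 i) //= iS (negbTE iA) mul0r.
rewrite (bigID (mem A)) /= [X in _ * X]big1 ?mulr1; last first.
  by move=> i /negbTE->; rewrite add0r.
by rewrite -prodr_const; apply: eq_bigr => i ->; rewrite addrC.
Qed.

(** Since [S] lies in [A], the sign is (-1)^|A| (-1)^|S|, which turns [x] into [- x] in the previous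
    sum. *)
Lemma sum_subset_signr (R : comNzRingType) (T : finType) (A B : {set T}) (x : R) :
  B \subset A ->
  \sum_(S : {set T} | S \subset B) x ^+ #|S| * (-1) ^+ #|A :\: S| =
  (-1) ^+ #|A| * (1 - x) ^+ #|B|.
Proof.
move=> sBA; rewrite -sum_subset_expr mulr_sumr; apply: eq_bigr => S sSB.
have /subset_leq_card leSA := subset_trans sSB sBA.
rewrite cardsD (setIidPr (subset_trans sSB sBA)) -{2}(subnK leSA).
rewrite exprD (exprNn x) mulrC -mulrA; congr (_ * _).
by rewrite mulrA -exprMn mulN1r opprK expr1n mul1r.
Qed.

(** * Polynomial sequences and their extrapolation *)

(** Being polynomial of degree less than [K] is expressed by the vanishing of the [K]-th difference.
    This covers binomial coefficients over rings where factorials are not invertible. *)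
Fixpoint poly_seq_lt (R : nzRingType) (K : nat) (a : nat -> R) : Prop :=
  if K is K'.+1 then poly_seq_lt K' (fun M => a M.+1 - a M)
  else forall M, a M = 0.

Definition poly_seq (R : nzRingType) (a : nat -> R) := exists K, poly_seq_lt K a.

Section PolySeq.
Variable R : comNzRingType.
Implicit Types a b : nat -> R.

Lemma eq_poly_seq_lt K a b : a =1 b -> poly_seq_lt K a -> poly_seq_lt K b.
Proof.
elim: K a b => [|K IH] a b eqab /=; first by move=> a0 M; rewrite -eqab.
by apply: IH => M; rewrite !eqab.
Qed.

Lemma poly_seq_lt0 K a : (forall M, a M = 0) -> poly_seq_lt K a.
Proof.
by elim: K a => [|K IH] a a0 //=; apply: IH => M; rewrite !a0 subr0.
Qed.

Lemma poly_seq_ltS K a : poly_seq_lt K a -> poly_seq_lt K.+1 a.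
Proof.
elim: K a => [|K IH] a pa; last exact: IH.
by move=> M; rewrite !pa subr0.
Qed.

Lemma poly_seq_lt_leq K K' a : (K <= K')%N -> poly_seq_lt K a -> poly_seq_lt K' a.
Proof.
by move/subnK<-; elim: (K' - K)%N => // k IH /IH pa; rewrite addSn; apply: poly_seq_ltS.
Qed.

Lemma poly_seq_ltD K a b :
  poly_seq_lt K a -> poly_seq_lt K b -> poly_seq_lt K (fun M => a M + b M).
Proof.
elim: K a b => [|K IH] a b /= pa pb; first by move=> M; rewrite pa pb addr0.
apply: eq_poly_seq_lt (IH _ _ pa pb) => M /=; ring.
Qed.

(** Discrete Leibniz rule: the difference of [a b] is [da b + a db + da db]. Induction on [K + L]
    bounds each of the three terms. *)
Lemma poly_seq_ltM K a b : forall L,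
  poly_seq_lt K a -> poly_seq_lt L b -> poly_seq_lt (K + L) (fun M => a M * b M).
Proof.
move=> L; have [k] := ubnP (K + L); elim: k => // k IH in K L a b *.
rewrite ltnS => leKL.
case: K leKL => [|K] leKL pa pb.
  by apply: poly_seq_lt0 => M; rewrite pa mul0r.
case: L leKL pb => [|L] leKL pb.
  by apply: poly_seq_lt0 => M; rewrite pb mulr0.
have -> : (K.+1 + L.+1 = (K + L.+1).+1)%N by lia.
rewrite /=.
set da := fun M => a M.+1 - a M; set db := fun M => b M.+1 - b M.
have p1 : poly_seq_lt (K + L.+1) (fun M => da M * b M).
  by apply: IH => //; lia.
have p2 : poly_seq_lt (K + L.+1) (fun M => a M * db M).
  by rewrite -addSnnS; apply: IH => //; lia.
have p3 : poly_seq_lt (K + L.+1) (fun M => da M * db M).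
  rewrite -addSnnS addSn; apply: poly_seq_ltS; apply: IH => //; lia.
apply: eq_poly_seq_lt (poly_seq_ltD (poly_seq_ltD p1 p2) p3) => M.
by rewrite /da /db; ring.
Qed.

Lemma eq_poly_seq a b : a =1 b -> poly_seq a -> poly_seq b.
Proof. by move=> eqab [K pa]; exists K; apply: eq_poly_seq_lt pa. Qed.

Lemma poly_seq_const (x : R) : poly_seq (fun=> x).
Proof. by exists 1%N => M /=; rewrite subrr. Qed.

Lemma poly_seqD a b : poly_seq a -> poly_seq b -> poly_seq (fun M => a M + b M).
Proof.
move=> [K pa] [L pb]; exists (maxn K L); apply: poly_seq_ltD.
  exact: poly_seq_lt_leq (leq_maxl _ _) pa.
exact: poly_seq_lt_leq (leq_maxr _ _) pb.
Qed.

Lemma poly_seqM a b : poly_seq a -> poly_seq b -> poly_seq (fun M => a M * b M).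
Proof. by move=> [K pa] [L pb]; exists (K + L)%N; apply: poly_seq_ltM. Qed.

Lemma poly_seq_diff a : poly_seq (fun M => a M.+1 - a M) -> poly_seq a.
Proof. by case=> K pa; exists K.+1. Qed.

Lemma poly_seq_sum (I : Type) (r : seq I) (P : pred I) (F : I -> nat -> R) :
  (forall i, P i -> poly_seq (F i)) -> poly_seq (fun M => \sum_(i <- r | P i) F i M).
Proof.
move=> pF; elim: r => [|i r IH].
  by apply: eq_poly_seq (poly_seq_const 0) => M; rewrite big_nil.
have [Pi|nPi] := boolP (P i).
  by apply: eq_poly_seq (poly_seqD (pF i Pi) IH) => M; rewrite big_cons Pi.
by apply: eq_poly_seq IH => M; rewrite big_cons (negbTE nPi).
Qed.

Lemma poly_seq_prod (I : eqType) (r : seq I) (F : I -> nat -> R) :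
  {in r, forall i, poly_seq (F i)} -> poly_seq (fun M => \prod_(i <- r) F i M).
Proof.
elim: r => [|i r IH] pF.
  by apply: eq_poly_seq (poly_seq_const 1) => M; rewrite big_nil.
apply: (@eq_poly_seq (fun M => F i M * \prod_(i <- r) F i M)).
  by move=> M; rewrite big_cons.
apply: poly_seqM; first by apply: pF; rewrite mem_head.
by apply: IH => j jr; apply: pF; rewrite in_cons jr orbT.
Qed.

(** The difference sequence also vanishes at every positive index, hence at 0 by induction on [K];
    so [a 0] equals [a 1], which is zero. *)
Lemma poly_seq_lt_eq0 K a : poly_seq_lt K a -> (forall M, a M.+1 = 0) -> a 0%N = 0.
Proof.
elim: K a => [|K IH] a /= pa a0; first exact: pa.
have /eqP : a 1%N - a 0%N = 0.
  by apply: (IH (fun M => a M.+1 - a M)) => // M; rewrite !a0 subrr.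
by rewrite a0 sub0r oppr_eq0 => /eqP.
Qed.

(** With index M = N + 1, this carries an identity known for all N >= 0 over to N = -1. *)
Lemma poly_seq_extrapolate a b :
  poly_seq a -> poly_seq b -> (forall M, a M.+1 = b M.+1) -> a 0%N = b 0%N.
Proof.
move=> pa pb eqab; apply/eqP; rewrite -subr_eq0; apply/eqP.
have [K pab] := poly_seqD pa (poly_seqM (poly_seq_const (-1)) pb).
have /= := poly_seq_lt_eq0 pab; rewrite mulN1r; apply => M.
by rewrite eqab mulN1r subrr.
Qed.

End PolySeq.

(** * Strict order polynomials *)

Section StrictMaps.
Variables (n : nat) (o : {set 'I_n * 'I_n}).
Implicit Types A S : {set 'I_n}.

Definition sinks_in A : {set 'I_n} :=
  [set x in A | [forall y in A, ~~ arc o x y]].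

(** Encodes the maps from [A] to [{0, ..., N - 1}] that increase along the arcs:
    the points outside [A] are exactly those sent to the extra value [N]. *)
Definition strict_maps A N : {set {ffun 'I_n -> 'I_N.+1}} :=
  [set c : {ffun 'I_n -> 'I_N.+1} |
     [forall x, (c x < N)%N == (x \in A)] &&
     [forall x in A, forall y in A, arc o x y ==> (c x < c y)%N]].

Lemma strict_mapsP A N (c : {ffun 'I_n -> 'I_N.+1}) :
  reflect ((forall x, (c x < N)%N = (x \in A)) /\
           {in A &, forall x y, arc o x y -> (c x < c y)%N})
          (c \in strict_maps A N).
Proof.
rewrite inE; apply: (iffP andP) => [[/forallP cA /forall_inP cs]|[cA cs]]; split.
- by move=> x; apply: (eqP (cA x)).
- by move=> x y xA yA; apply/implyP; move/forall_inP: (cs x xA); apply.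
- by apply/forallP => x; rewrite cA.
- apply/forall_inP => x xA; apply/forall_inP => y yA; apply/implyP; exact: cs.
Qed.

Lemma sinks_inP A x :
  reflect (x \in A /\ {in A, forall y, ~~ arc o x y}) (x \in sinks_in A).
Proof. by rewrite inE; apply: (iffP andP) => -[xA /forall_inP]. Qed.

Lemma sinks_in_sub A : sinks_in A \subset A.
Proof. by apply/subsetP => x /sinks_inP[]. Qed.

Lemma card_strict_maps0 A : #|strict_maps A 0| = (A == set0).
Proof.
have [->|[x xA]] := set_0Vmem A.
  rewrite eqxx; apply/eqP/cards1P; exists [ffun=> ord0].
  apply/setP => c; rewrite in_set1; apply/strict_mapsP/eqP => [_|->].
    by apply/ffunP => x; rewrite ffunE; apply: ord1.
  by split=> [x|x y]; rewrite ?inE.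
rewrite (_ : A == set0 = false); last by apply/eqP => A0; rewrite A0 inE in xA.
by apply/eqP; rewrite cards_eq0; apply/set0Pn => -[c /strict_mapsP[/(_ x)]]; rewrite xA.
Qed.

(** Group the maps into {0, ..., N} by the set [S] of points of [A] with the top value [N]. Nothing
    in [A] lies above such points, so they are sinks of [A], and the other points map strictly into
    {0, ..., N - 1}. *)
Lemma card_strict_mapsS A N :
  #|strict_maps A N.+1| =
  (\sum_(S : {set 'I_n} | S \subset sinks_in A) #|strict_maps (A :\: S) N|)%N.
Proof.
pose top (c : {ffun 'I_n -> 'I_N.+2}) := [set x in A | c x == N :> nat].
rewrite -sum1_card (partition_big top (fun S => S \subset sinks_in A)) /=.
  apply: eq_bigr => S /subsetP sS; rewrite -sum1_card.
  (* Truncation at [N] merges the value [N] on [S] with the extra value [N + 1] outside [A] into the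
     extra value of the smaller encoding. *)
  apply: (@big_rel_bij _ _ _ _ _ _ _
    (fun (c : {ffun 'I_n -> 'I_N.+2}) (c' : {ffun 'I_n -> 'I_N.+1}) =>
       [forall x, minn (c x) N == c' x])) => //.
  - move=> c /andP[/strict_mapsP[cA cs] /eqP cS].
    exists [ffun x => inord (minn (c x) N)].
      have lec x : (minn (c x) N < N.+1)%N by rewrite ltnS geq_minr.
      have ltc x : (minn (c x) N < N)%N = (x \in A :\: S).
        rewrite -cS !inE -cA; move: (nat_of_ord (c x)) => k; lia.
      apply/strict_mapsP; split=> [x|x y xA yA xy]; rewrite !ffunE !inordK //.
      have := ltc x; rewrite xA; have := cs x y _ _ xy.
      rewrite !(subsetP (subsetDl A S)) // => /(_ isT isT).
      by move: (nat_of_ord (c x)) (nat_of_ord (c y)) => k l; lia.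
    by apply/forallP => x; rewrite ffunE inordK // ltnS geq_minr.
  - move=> c /strict_mapsP[cA cs].
    have dK x : ((if x \in A then c x : nat else N.+1) < N.+2)%N.
      by case: ifP => // _; rewrite ltnS ltnW.
    have cN x : (c x <= N)%N by rewrite -ltnS.
    have sSA x : x \in S -> x \in A by move=> /sS /sinks_inP[].
    (* Points of [S] already carry the value [N], being outside [A :\: S]; only the points outside
       [A] must be raised to [N + 1]. *)
    exists [ffun x => inord (if x \in A then c x : nat else N.+1)].
      apply/andP; split.
        apply/strict_mapsP; split=> [x|x y xA yA xy]; rewrite !ffunE !inordK //.
          by case: ifP => _; [rewrite ltnS cN | rewrite ltnn].
        rewrite xA yA; have xS : x \notin S.
          by apply/negP => /sS /sinks_inP[_ /(_ y yA)]; rewrite xy.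
        have [yS|yS] := boolP (y \in S).
          by have := cA x; have := cA y; have := cN y; rewrite !inE xS xA yS /=;
            move: (nat_of_ord (c x)) (nat_of_ord (c y)) => k l; lia.
        by apply: cs; rewrite ?inE ?xS ?yS.
      apply/eqP/setP => x; rewrite inE ffunE inordK //.
      have [xA|xA] := boolP (x \in A) => /=.
        by have := cA x; have := cN x; rewrite inE xA; case: (x \in S) => /=;
          move: (nat_of_ord (c x)) => k; lia.
      by apply/esym; apply: contraNF xA => /sSA.
    apply/forallP => x; rewrite ffunE inordK //.
    have [xA|xA] := boolP (x \in A); first by apply/eqP/minn_idPl.
    by have := cA x; have := cN x; rewrite inE (negbTE xA) andbF;
      move: (nat_of_ord (c x)) => k; lia.
  - move=> c d d' _ _ _ /forallP cd /forallP cd'; apply/ffunP => x.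
    by apply/val_inj/eqP; rewrite /= -(eqP (cd x)) -(eqP (cd' x)).
  move=> c c' d /andP[/strict_mapsP[cA _] _] /andP[/strict_mapsP[cA' _] _] _.
  move=> /forallP cd /forallP cd'; apply/ffunP => x; apply/val_inj => /=.
  have := ltn_ord (c x); have := ltn_ord (c' x).
  have := cA x; have := cA' x; have := eqP (cd x); have := eqP (cd' x).
  move: (nat_of_ord (c x)) (nat_of_ord (c' x)) (nat_of_ord (d x)) => k k' l.
  by case: (x \in A); lia.
move=> c /strict_mapsP[cA cs]; apply/subsetP => x; rewrite !inE => /andP[xA /eqP cx].
rewrite xA; apply/forall_inP => y yA; apply/negP => /(cs x y xA yA).
by have := cA y; rewrite yA cx; move: (nat_of_ord (c y)) => k; lia.
Qed.

Lemma sum_strict_maps (R : comNzRingType) (v : R) N :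
  \sum_(c : {ffun 'I_n -> 'I_N.+1} | [forall x, forall y, arc o x y ==> (c x < c y)%N])
     v ^+ #|[set x | c x == ord_max]| =
  \sum_(S : {set 'I_n} | S \subset sinks o) v ^+ #|S| *+ #|strict_maps (~: S) N|.
Proof.
rewrite (partition_big (fun c : {ffun 'I_n -> 'I_N.+1} => [set x | c x == ord_max])
                       (fun S => S \subset sinks o)) /=.
  apply: eq_bigr => S sS; rewrite -sumr_const.
  apply: eq_big => [c|c /andP[_ /eqP-> //]].
  apply/andP/strict_mapsP => [[/forallP cs /eqP cS]|[cA cs]].
    split=> [x|x y _ _ xy]; last by move/forallP: (cs x) => /(_ y) /implyP; apply.
    by rewrite -cS !inE -val_eqE /=; have := ltn_ord (c x);
      move: (nat_of_ord (c x)) => k; lia.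
  split.
    apply/forallP => x; apply/forallP => y; apply/implyP => xy.
    have xS : x \notin S.
      apply/negP => /(subsetP sS); rewrite inE => /forallP/(_ y); by rewrite xy.
    have [yS|yS] := boolP (y \in S); last by apply: cs; rewrite ?inE.
    by have := cA x; have := cA y; have := ltn_ord (c y); rewrite !inE yS xS /=;
      move: (nat_of_ord (c x)) (nat_of_ord (c y)) => k l; lia.
  apply/eqP/setP => x; rewrite inE -val_eqE /=.
  by have := cA x; have := ltn_ord (c x); rewrite inE; case: (x \in S) => /=;
          move: (nat_of_ord (c x)) => k; lia.
move=> c /forallP cs; apply/subsetP => x; rewrite !inE => /eqP cx.
apply/forallP => y; apply/negP => xy.
by move/forallP: (cs x) => /(_ y) /implyP/(_ xy); rewrite cx ltnNge -ltnS ltn_ord.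
Qed.

Hypothesis acyclic_o : acyclic o.

(** Take [x] in [A] reaching the fewest vertices. An arc from [x] to some [y] in [A] would make the
    set reached by [y] strictly smaller, as it misses [x]. *)
Lemma acyclic_sinks_in A : A != set0 -> sinks_in A != set0.
Proof.
case/set0Pn => x0 x0A.
case: (arg_minnP (fun x => #|connect (arc o) x|) x0A) => x xA minx.
apply/set0Pn; exists x; apply/sinks_inP; split=> // y yA; apply/negP => xy.
have := minx y yA; rewrite leqNgt => /negP; apply; apply: proper_card.
apply/properP; split.
  by apply/subsetP => z; apply: connect_trans; apply: connect1.
exists x; first exact: connect0.
by move/forallP: acyclic_o => /(_ x) /forallP/(_ y) /implyP/(_ xy).
Qed.

Variable R : comNzRingType.

(** The strict order polynomial of [A] with the argument shifted by one; the
    value at [0] is its value at [-1], as given by reciprocity. *)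
Definition strict_order_seq A (M : nat) : R :=
  if M is N.+1 then #|strict_maps A N|%:R else (-1) ^+ #|A|.

(** For positive [M] this is the recursion on the top value. At [M = 0] the right side is (-1)^|A|
    (1 - 1)^s with s the number of sinks of [A]; by acyclicity s = 0 only for empty [A], which
    matches the count of maps into the empty set. This is the reciprocity. *)
Lemma strict_order_seqS A M :
  strict_order_seq A M.+1 =
  \sum_(S : {set 'I_n} | S \subset sinks_in A) strict_order_seq (A :\: S) M.
Proof.
case: M => [|N] /=; last by rewrite card_strict_mapsS natr_sum.
rewrite card_strict_maps0; transitivity ((-1) ^+ #|A| * (1 - 1) ^+ #|sinks_in A| : R).
  rewrite subrr expr0n; have [->|nzA] := eqVneq A set0.
    rewrite cards0 (_ : sinks_in set0 = set0) ?cards0 ?mulr1 //.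
    by apply/eqP; rewrite -subset0 sinks_in_sub.
  by rewrite cards_eq0 (negbTE (acyclic_sinks_in nzA)) mulr0.
rewrite -(sum_subset_signr _ (sinks_in_sub A)); apply: eq_bigr => S _.
by rewrite expr1n mul1r.
Qed.

(** The term of the empty [S] in the recursion is the sequence itself, so the difference is a sum
    over nonempty [S], and induction on the size of [A] applies. *)
Lemma strict_order_seq_poly A : poly_seq (strict_order_seq A).
Proof.
have [k] := ubnP #|A|; elim: k => // k IH in A *; rewrite ltnS => leA.
apply: poly_seq_diff; apply: (@eq_poly_seq _ (fun M =>
  \sum_(S : {set 'I_n} | (S \subset sinks_in A) && (S != set0))
     strict_order_seq (A :\: S) M)).
  by move=> M; rewrite strict_order_seqS [in RHS](bigD1 set0) ?sub0set //= setD0 addrAC subrr add0r.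
apply: poly_seq_sum => S /andP[sS nzS]; apply: IH.
apply: leq_trans leA.
have /subset_trans/(_ (sinks_in_sub A)) sSA := sS.
rewrite cardsD (setIidPr sSA) ltn_subrL card_gt0 nzS.
by apply: leq_trans (subset_leq_card sSA); rewrite card_gt0.
Qed.

End StrictMaps.

(** * Evaluation of power series *)

Lemma leq_mdeg (m : {cmonom nat}) i : (m i <= mdeg m)%N.
Proof.
case: (mdomP m i) => // mi; rewrite mdegE.
by rewrite (big_fsetD1 i) //= leq_addr.
Qed.

Lemma coloring_monomialE n (c : 'I_n -> nat) i :
  coloring_monomial c i = #|[set x | c x == i]|.
Proof.
rewrite /coloring_monomial (big_morph (fun m : {cmonom nat} => m i)
  (id1 := 0%N) (op1 := addn)); last exact: cm1.
  rewrite -sum1dep_card [RHS]big_mkcond /=; apply: eq_bigr => x _.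
  by rewrite cmU; case: eqP.
by move=> m1 m2; rewrite cmM.
Qed.

Lemma eq_proper_coloring n (G : rel 'I_n) (c d : 'I_n -> nat) :
  c =1 d -> proper_coloring G c = proper_coloring G d.
Proof.
by move=> eqcd; apply: eq_forallb => x; apply: eq_forallb => y; rewrite !eqcd.
Qed.

Lemma eq_asc_coloring n (G : rel 'I_n) (c d : 'I_n -> nat) :
  c =1 d -> asc_coloring G c = asc_coloring G d.
Proof. by move=> eqcd; apply: eq_card => p; rewrite !inE !eqcd. Qed.

Lemma eq_coloring_monomial n (c d : 'I_n -> nat) :
  c =1 d -> coloring_monomial c = coloring_monomial d.
Proof. by move=> eqcd; apply: eq_bigr => x _; rewrite eqcd. Qed.

Section Monomials.
Variables n N : nat.
Implicit Type a : {ffun 'I_N.+1 -> 'I_n.+1}.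

(** Exponent vectors bounded by [n] in the variables x_0, ..., x_N form one fixed finite type, over
    which evaluations can be summed. *)
Definition mnm_of a : {cmonom nat} :=
  [cmonom (a (inord i) : nat) | i in seq_fset tt (iota 0 N.+1)]%M.

Lemma mnm_ofE a i : mnm_of a i = if (i < N.+1)%N then a (inord i) : nat else 0%N.
Proof. by rewrite /mnm_of cmE [LHS]fsfunE seq_fsetE mem_iota add0n. Qed.

Lemma mnm_of_ord a (i : 'I_N.+1) : mnm_of a i = a i.
Proof. by rewrite mnm_ofE ltn_ord inord_val. Qed.

Lemma mnm_of_inj : injective mnm_of.
Proof.
move=> a b eqab; apply/ffunP => i; apply: val_inj.
by rewrite /= -!mnm_of_ord eqab.
Qed.

Lemma mnm_of_surj (m : {cmonom nat}) :
  (forall i, (N < i)%N -> m i = 0%N) -> (forall i, (m i <= n)%N) ->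
  exists a, mnm_of a = m.
Proof.
move=> supp_m le_m; exists [ffun i : 'I_N.+1 => inord (m i)].
apply/eqP/cmP => i; rewrite mnm_ofE; case: ltnP => [iN|/supp_m //].
by rewrite ffunE !inordK // ltnS.
Qed.

Lemma mdeg_mnm_of a : mdeg (mnm_of a) = (\sum_i a i)%N.
Proof.
rewrite (@mdegEw _ _ (seq_fset tt (iota 0 N.+1))); last first.
  apply/fsubsetP => i; rewrite -cmE_neq0 mnm_ofE seq_fsetE mem_iota add0n.
  by case: ltnP.
rewrite (perm_big (iota 0 N.+1)); last first.
  apply: uniq_perm => [||i]; last by rewrite seq_fsetE.
    exact: fset_uniq.
  exact: iota_uniq.
transitivity (\sum_(0 <= i < N.+1) mnm_of a i)%N; first by rewrite /index_iota subn0.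
by rewrite big_mkord; apply: eq_bigr => i _; rewrite mnm_of_ord.
Qed.

End Monomials.

Definition fps_homog (R : comNzRingType) (d : nat) (f : fps R) :=
  forall m, f m != 0 -> mdeg m = d.

Lemma fps_one_homog (R : comNzRingType) : fps_homog 0 (fps_one R).
Proof.
by move=> m; rewrite /fps_one; have [->|_] := eqVneq m mone; rewrite ?mdeg1 ?eqxx.
Qed.

Lemma fps_esym_homog (R : comNzRingType) k : fps_homog k (fps_esym R k).
Proof.
by move=> m; rewrite /fps_esym; have [//|_] := eqVneq (mdeg m) k; rewrite eqxx.
Qed.

Lemma fps_mul_homog (R : comNzRingType) d e (f g : fps R) :
  fps_homog d f -> fps_homog e g -> fps_homog (d + e) (fps_mul f g).
Proof.
move=> hf hg m; apply: contra_neq_eq => ndeg.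
rewrite /fps_mul big1 // => -[k l] /= /eqP def_m; apply/eqP/negPn/negP => nz.
case/eqP: ndeg; rewrite -def_m mdegM (hf (submon k)) ?(hg (submon l)) //.
  by apply: contraNneq nz => ->; rewrite mulr0.
by apply: contraNneq nz => ->; rewrite mul0r.
Qed.

Lemma fps_prod_esym_homog (R : comNzRingType) (ks : seq nat) :
  fps_homog (sumn ks) (\big[@fps_mul R/fps_one R]_(k <- ks) fps_esym R k).
Proof.
elim: ks => [|k ks IH]; first by rewrite big_nil; apply: fps_one_homog.
by rewrite big_cons; apply: fps_mul_homog IH; apply: fps_esym_homog.
Qed.

Section Evaluation.
Variables (R : comNzRingType) (v : {poly R}) (n N : nat).
Implicit Types (f g : fps R) (a b c : {ffun 'I_N.+1 -> 'I_n.+1}).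

(** The value at [x_0 = ... = x_(N-1) = 1], [x_N = v], and [x_i = 0] for [i > N],
    provided [f] has degree at most [n]. *)
Definition fps_eval f : {poly R} :=
  \sum_(a : {ffun 'I_N.+1 -> 'I_n.+1}) (f (mnm_of a))%:P * v ^+ a ord_max.

(** Divisors of a monomial [mnm_of a] are again of this form, so the index type of [fps_mul], which
    depends on the monomial, can be exchanged for pairs of bounded exponent vectors. *)
Lemma fps_mul_mnm_of f g a :
  fps_mul f g (mnm_of a) =
  \sum_(p : {ffun 'I_N.+1 -> 'I_n.+1} * {ffun 'I_N.+1 -> 'I_n.+1}
       | mmul (mnm_of p.1) (mnm_of p.2) == mnm_of a)
     f (mnm_of p.1) * g (mnm_of p.2).
Proof.
have divisor m1 m2 : mmul m1 m2 = mnm_of a -> exists b, mnm_of b = m1.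
  move=> def_a; have le_m i : (m1 i <= mnm_of a i)%N by rewrite -def_a cmM leq_addr.
  apply: mnm_of_surj => i => [Ni|].
    by apply/eqP; rewrite -leqn0 (leq_trans (le_m i)) // mnm_ofE ltnNge Ni.
  apply: leq_trans (le_m i) _; rewrite mnm_ofE; case: ifP => // _.
  by rewrite -ltnS ltn_ord.
apply: (@big_rel_bij _ _ _ _ _ _ _ (fun k p =>
  (submon k.1 == mnm_of p.1) && (submon k.2 == mnm_of p.2))).
- move=> [k l] /= /eqP def_a; have [b def_b] := divisor _ _ def_a.
  have [c def_c] : exists c, mnm_of c = submon l.
    by apply: (divisor _ (submon k)); rewrite mulmC.
  by exists (b, c); rewrite /= def_b def_c ?eqxx ?def_a.
- move=> [b c] /= /eqP def_a; have [k def_k] := submonP def_a.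
  have [l def_l] : exists l : {ffun finsupp (mnm_of a) -> 'I_(mdeg (mnm_of a)).+1},
      submon l = mnm_of c.
    by apply: (@submonP _ _ (mnm_of b)); rewrite mulmC.
  by exists (k, l); rewrite /= def_k def_l ?eqxx ?def_a.
- move=> [k l] [b c] [b' c'] _ _ _ /= /andP[/eqP-> /eqP->].
  by move=> /andP[/eqP/mnm_of_inj-> /eqP/mnm_of_inj->].
- move=> [k l] [k' l'] [b c] _ _ _ /= /andP[/eqP<- /eqP<-].
  by move=> /andP[/eqP/submon_inj-> /eqP/submon_inj->].
by move=> [k l] [b c] _ _ /= /andP[/eqP-> /eqP->].
Qed.

(** Exchange the sums. A pair of monomials with nonzero coefficients has total degree [d + e], at
    most [n], so its product is not lost by the bound on exponents; all other pairs contribute zero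
    on both sides. *)
Lemma fps_evalM d e f g : fps_homog d f -> fps_homog e g -> (d + e <= n)%N ->
  fps_eval (fps_mul f g) = fps_eval f * fps_eval g.
Proof.
move=> hf hg le_n; rewrite /fps_eval.
transitivity (\sum_(a : {ffun 'I_N.+1 -> 'I_n.+1})
  \sum_(p : {ffun 'I_N.+1 -> 'I_n.+1} * {ffun 'I_N.+1 -> 'I_n.+1}
    | mmul (mnm_of p.1) (mnm_of p.2) == mnm_of a)
    (f (mnm_of p.1) * g (mnm_of p.2))%:P * v ^+ a ord_max).
  by apply: eq_bigr => a _; rewrite fps_mul_mnm_of rmorph_sum mulr_suml.
rewrite (exchange_big_dep xpredT) //= big_distrlr /= pair_big /=.
apply: eq_bigr => -[b c] _ /=.
have [fg0|nz] := eqVneq (f (mnm_of b) * g (mnm_of c)) 0.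
  rewrite fg0 big1 => [|a _]; last by rewrite mul0r.
  by rewrite mulrACA -polyCM fg0 mul0r.
have deg_b : mdeg (mnm_of b) = d.
  by apply: hf; apply: contraNneq nz => ->; rewrite mul0r.
have deg_c : mdeg (mnm_of c) = e.
  by apply: hg; apply: contraNneq nz => ->; rewrite mulr0.
have [a def_a] : exists a, mnm_of a = mmul (mnm_of b) (mnm_of c).
  apply: mnm_of_surj => i => [Ni|]; first by rewrite cmM !mnm_ofE ltnNge Ni.
  by rewrite (leq_trans (leq_mdeg _ _)) // mdegM deg_b deg_c.
rewrite (big_pred1 a) => [|a' /=]; last first.
  by rewrite -def_a eq_sym (inj_eq (@mnm_of_inj _ _)).
have -> : (a ord_max = b ord_max + c ord_max :> nat)%N.
  by rewrite -!mnm_of_ord def_a cmM.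
by rewrite exprD polyCM mulrACA.
Qed.

Lemma fps_eval_one : fps_eval (fps_one R) = 1.
Proof.
have [a def_a] : exists a, mnm_of a = mone.
  by apply: mnm_of_surj => i; rewrite cm1.
rewrite /fps_eval (bigD1 a) //= big1 => [|b ne_ba]; last first.
  by rewrite /fps_one -def_a (inj_eq (@mnm_of_inj _ _)) (negbTE ne_ba) mul0r.
by rewrite /fps_one -mnm_of_ord def_a eqxx cm1 mulr1 addr0.
Qed.

(** Squarefree monomials of degree [k] correspond to [k]-subsets of {0, ..., N}; a subset has weight
    [v] if it contains [N] and 1 otherwise. At [k = 0] the truncated predecessor would add a
    spurious [v]. *)
Lemma fps_eval_esym k : (0 < k <= n)%N ->
  fps_eval (fps_esym R k) = 'C(N, k)%:R + v *+ 'C(N, k.-1).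
Proof.
case: k => // k /= lt_kn; rewrite /fps_eval.
transitivity (\sum_(S : {set 'I_N.+1} | #|S| == k.+1) v ^+ (ord_max \in S)).
  rewrite (bigID (fun a => (mdeg (mnm_of a) == k.+1)
    && [forall i : finsupp (mnm_of a), mnm_of a (val i) == 1%N])) /=.
  rewrite addrC big1 ?add0r => [|a]; last first.
    by rewrite /fps_esym => /negbTE->; rewrite mul0r.
  have sqfree a : [forall i : finsupp (mnm_of a), mnm_of a (val i) == 1%N] =
      [forall i, (a i <= 1)%N].
    apply/forallP/forallP => [sq i|sq [i /= i_a]].
      rewrite -mnm_of_ord; case: mdomP => // ia.
      by have /eqP := sq [` ia]%fset; rewrite /= => ->.
    move: i_a; rewrite -cmE_neq0 mnm_ofE; case: ifP => // _.
    by have := sq (inord i); move: (nat_of_ord _) => x; lia.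
  apply: (@big_rel_bij _ _ _ _ _ _ _
    (fun a (S : {set 'I_N.+1}) => [forall i, (a i : nat) == (i \in S)])).
  - move=> a /andP[/eqP deg_a]; rewrite sqfree => /forallP sq.
    have aS i : (a i : nat) == (i \in [set i | a i == 1%N :> nat]).
      by rewrite inE; have := sq i; move: (nat_of_ord _) => x; lia.
    exists [set i | a i == 1%N :> nat]; last by apply/forallP.
    rewrite -deg_a mdeg_mnm_of -sum1_card big_mkcond /=; apply/eqP.
    by apply: eq_bigr => i _; rewrite (eqP (aS i)); case: (i \in _).
  - move=> S /eqP cardS.
    have le1 i : (i \in S < n.+1)%N by case: (i \in S) => //; lia.
    exists [ffun i => inord (i \in S)].
      rewrite sqfree mdeg_mnm_of -cardS -sum1_card [X in _ == X]big_mkcond /=.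
      apply/andP; split.
        by apply/eqP/eq_bigr => i _; rewrite ffunE inordK //; case: (i \in S).
      by apply/forallP => i; rewrite ffunE inordK //; case: (i \in S).
    by apply/forallP => i; rewrite ffunE inordK.
  - move=> a S S' _ _ _ /forallP aS /forallP aS'; apply/setP => i.
    have := aS i; rewrite (eqP (aS' i)).
    by case: (i \in S); case: (i \in S').
  - move=> a a' S _ _ _ /forallP aS /forallP aS'; apply/ffunP => i.
    by apply/val_inj; rewrite /= (eqP (aS i)) (eqP (aS' i)).
  move=> a S /= sqa _ /forallP aS; rewrite /fps_esym sqa mul1r.
  by rewrite (eqP (aS ord_max)).
rewrite (bigID (fun S : {set 'I_N.+1} => ord_max \in S)) /= addrC.
set A := [set~ (ord_max : 'I_N.+1)].
have cardA : #|A| = N by rewrite cardsC1 card_ord.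
have cardNmem : #|[set S : {set 'I_N.+1} | (#|S| == k.+1) && (ord_max \notin S)]|
    = 'C(N, k.+1).
  have := cards_draws A k.+1; rewrite cardA => <-.
  apply: eq_card => S; rewrite !inE andbC.
  by rewrite subsetC sub1set inE.
(* Pascal's rule: subtract the subsets avoiding [N] from all subsets of size [k + 1]. *)
have cardmem : #|[set S : {set 'I_N.+1} | (#|S| == k.+1) && (ord_max \in S)]|
    = 'C(N, k).
  have := card_draws 'I_N.+1 k.+1; rewrite card_ord binS.
  rewrite -(cardsID [set S : {set 'I_N.+1} | ord_max \in S]) -cardNmem.
  rewrite addnC (_ : _ :\: _ = [set S : {set 'I_N.+1} | (#|S| == k.+1) && (ord_max \notin S)]).
    move/addnI <-; apply: eq_card => S; by rewrite !inE.
  by apply/setP => S; rewrite !inE andbC.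
congr (_ + _).
  rewrite (eq_bigr (fun=> 1)); last by move=> S /andP[_ /negbTE->].
  by rewrite -cardNmem -sumr_const; apply: eq_bigl => S; rewrite inE.
rewrite (eq_bigr (fun=> v)); last by move=> S /andP[_ ->].
by rewrite -cardmem -sumr_const; apply: eq_bigl => S; rewrite inE.
Qed.

Lemma fps_eval_prod_esym (ks : seq nat) :
  all (leq 1) ks -> (sumn ks <= n)%N ->
  fps_eval (\big[@fps_mul R/fps_one R]_(k <- ks) fps_esym R k) =
  \prod_(k <- ks) ('C(N, k)%:R + v *+ 'C(N, k.-1)).
Proof.
elim: ks => [|k ks IH] /=; first by rewrite !big_nil fps_eval_one.
move=> /andP[k_gt0 ks_gt0] le_n.
rewrite !big_cons (fps_evalM (@fps_esym_homog R k) (@fps_prod_esym_homog R ks)) //.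
rewrite IH ?fps_eval_esym ?k_gt0 //=; first exact: leq_trans (leq_addr _ _) le_n.
exact: leq_trans (leq_addl _ _) le_n.
Qed.

End Evaluation.

(** Group the colourings with values at most [N] by the sizes of their colour classes: these are the
    exponents of the monomial, and the class of colour [N] gives the power of [v]. *)
Lemma fps_eval_chromatic n N (G : rel 'I_n) (v : {poly {poly int}}) :
  fps_eval v n N (chromatic_qsym G) =
  \sum_(c : {ffun 'I_n -> 'I_N.+1} | proper_coloring G (fun i => c i))
     ('X^(asc_coloring G (fun i => c i)))%:P * v ^+ #|[set x | c x == ord_max]|.
Proof.
pose mult (c : {ffun 'I_n -> 'I_N.+1}) : {ffun 'I_N.+1 -> 'I_n.+1} :=
  [ffun i => inord #|[set x | c x == i]|].
have multE c i : mult c i = #|[set x | c x == i]| :> nat.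
  by rewrite ffunE inordK // ltnS -[leqRHS]card_ord max_card.
have mnm_mult c : mnm_of (mult c) = coloring_monomial (fun i => c i).
  apply/eqP/cmP => i; rewrite mnm_ofE coloring_monomialE; case: ltnP => [iN|Ni].
    by rewrite multE; apply: eq_card => x; rewrite !inE -val_eqE /= inordK.
  rewrite -[LHS](@cards0 'I_n); apply: eq_card => x; rewrite !inE.
  by apply/esym/negbTE; rewrite neq_ltn (leq_trans (ltn_ord _)).
rewrite (partition_big mult xpredT) //=; apply: eq_bigr => a _.
rewrite /chromatic_qsym rmorph_sum mulr_suml /=.
apply: (@big_rel_bij _ _ _ _ _ _ _
  (fun (c : {ffun 'I_n -> finsupp (mnm_of a)}) (d : {ffun 'I_n -> 'I_N.+1}) =>
     [forall x, val (c x) == d x])).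
- move=> c /andP[prop_c /eqP mon_c].
  pose d : {ffun 'I_n -> 'I_N.+1} := [ffun x => inord (val (c x))].
  have cd : (fun x => val (c x)) =1 (fun x => d x : nat).
    move=> x; rewrite ffunE inordK //.
    by have := valP (c x); rewrite -cmE_neq0 mnm_ofE; case: ifP.
  exists d; last by apply/forallP => x; apply/eqP/cd.
  rewrite -(eq_proper_coloring G cd) prop_c -(inj_eq (@mnm_of_inj _ _)) mnm_mult.
  by rewrite -(eq_coloring_monomial cd) mon_c eqxx.
- move=> d /andP[prop_d /eqP mult_d].
  have supp_d x : (d x : nat) \in finsupp (mnm_of a).
    by rewrite -mult_d mnm_mult; apply: (coloring_monomial_supp (fun i => d i)).
  pose c : {ffun 'I_n -> finsupp (mnm_of a)} := [ffun x => [` supp_d x]%fset].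
  have cd : (fun x => val (c x)) =1 (fun x => d x : nat).
    by move=> x; rewrite ffunE.
  exists c; last by apply/forallP => x; apply/eqP/cd.
  rewrite (eq_proper_coloring G cd) prop_d (eq_coloring_monomial cd).
  by rewrite -mnm_mult mult_d eqxx.
- move=> c d d' _ _ _ /forallP cd /forallP cd'; apply/ffunP => x.
  by apply: val_inj; rewrite /= -(eqP (cd x)) -(eqP (cd' x)).
- move=> c c' d _ _ _ /forallP cd /forallP cd'; apply/ffunP => x.
  by apply: val_inj; rewrite /= (eqP (cd x)) (eqP (cd' x)).
move=> c d _ /andP[_ /eqP mult_d] /forallP cd; rewrite -multE mult_d.
by rewrite (@eq_asc_coloring _ G _ (fun x => d x)) // => x; apply: (eqP (cd x)).
Qed.

(** The value of [e_k] at [1^N, v] as a polynomial in [N], with [M = N + 1];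
    at [M = 0] this uses the generalised binomial coefficient of [-1]. *)
Definition esym_seq (R : comNzRingType) (v : R) (k M : nat) : R :=
  if M is N.+1 then 'C(N, k)%:R + v *+ 'C(N, k.-1) else (-1) ^+ k * (1 - v).

(** By Pascal's rule the difference of the sequence for [k + 1] is the one for [k], also from index
    0 to 1 thanks to the value chosen at 0. The base case [k = 1] is N + v, which is linear. *)
Lemma esym_seq_poly (R : comNzRingType) (v : R) k :
  (0 < k)%N -> poly_seq (esym_seq v k).
Proof.
case: k => // k _; elim: k => [|k IH].
  exists 2%N => -[|M] /=; rewrite ?bin1 ?bin0 ?(natrS _ M.+1) ?(natrS _ M) /=; ring.
apply: poly_seq_diff; apply: eq_poly_seq IH => -[|M] /=.
  by rewrite !bin0n /= !mulr0n !exprS; ring.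
by rewrite !(binS M) !natrD !mulrnDr; ring.
Qed.

(** * From proper colourings to acyclic orientations *)

(** Orient each edge towards its larger colour: ascents of the colouring become ascents of the
    orientation, and the colourings inducing a given [o] are exactly the maps increasing along its
    arcs. *)
Lemma sum_proper_coloring_orientations n N (G : rel 'I_n) (R : comNzRingType)
    (F : nat -> R) (H : {ffun 'I_n -> 'I_N.+1} -> R) :
  symmetric G ->
  \sum_(c : {ffun 'I_n -> 'I_N.+1} | proper_coloring G (fun i => c i))
     F (asc_coloring G (fun i => c i)) * H c =
  \sum_(o : {set 'I_n * 'I_n} | is_orientation G o && acyclic o)
     F (asc_orientation o) *
     \sum_(c : {ffun 'I_n -> 'I_N.+1} | [forall x, forall y, arc o x y ==> (c x < c y)%N])
       H c.
Proof.
move=> symG.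
pose orient (c : {ffun 'I_n -> 'I_N.+1}) :=
  [set p : 'I_n * 'I_n | G p.1 p.2 && (c p.1 < c p.2)%N].
have arcE c x y : arc (orient c) x y = G x y && (c x < c y)%N by rewrite /arc inE.
rewrite (partition_big orient (fun o => is_orientation G o && acyclic o)) /=.
  apply: eq_bigr => o /andP[or_o _]; rewrite mulr_sumr.
  have arc_G x y : arc o x y -> G x y.
    by move/forallP: or_o => /(_ x) /forallP/(_ y); case: (G x y) => // /negbTE->.
  have G_arc x y : G x y -> arc o x y || arc o y x.
    move/forallP: or_o => /(_ x) /forallP/(_ y); case: (G x y) => //.
    by case: (arc o x y); case: (arc o y x).
  apply: eq_big => [c|c /andP[_ /eqP <-]]; last first.
    by congr (F _ * _); apply: eq_card => p; rewrite !inE -andbA; congr (_ && _);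
       rewrite andbC.
  apply/andP/forallP => [[_ /eqP <-] x|cs].
    by apply/forallP => y; rewrite arcE; apply/implyP => /andP[].
  have {}cs x y : arc o x y -> (c x < c y)%N.
    by move/forallP: (cs x) => /(_ y) /implyP.
  split.
    apply/forallP => x; apply/forallP => y; apply/implyP => /G_arc.
    by case/orP => /cs; rewrite neq_ltn => ->; rewrite ?orbT.
  apply/eqP/setP => -[x y]; rewrite -[LHS]/(arc _ x y) -[RHS]/(arc _ x y) arcE.
  apply/andP/idP => [[/G_arc/orP[//|/cs ltyx] ltxy]|xy]; last by rewrite arc_G ?cs.
  by rewrite ltnNge ltnW in ltxy.
move=> c /forallP prop_c; apply/andP; split.
  apply/forallP => x; apply/forallP => y; rewrite !arcE (symG y x).
  case Gxy: (G x y) => //=; move/forallP: (prop_c x) => /(_ y); rewrite Gxy /=.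
  by case: ltngtP.
apply/forallP => x; apply/forallP => y; rewrite arcE; apply/implyP => /andP[_ ltxy].
(* Colours increase along directed paths, so a path from [y] back to [x] would contradict the arc
   from [x] to [y]. *)
apply/negP => /connectP[p p_path def_x]; move: ltxy; rewrite ltnNge => /negP; apply.
rewrite {}def_x; elim: p y p_path => //= z p IH y /andP[].
by rewrite arcE => /andP[_ /ltnW leyz] /IH; apply: leq_trans.
Qed.

(** * Comparison of the two expansions at N = -1 *)

Lemma parts_gt0 n (la : partition_of n) : all (leq 1) (parts la).
Proof. exact: filter_all. Qed.

Lemma sumn_parts n (la : partition_of n) : sumn (parts la) = n.
Proof.
have /andP[_ /eqP {2}<-] := valP la.
rewrite /parts; elim: (map _ _) => //= k s IH.
by case: k => [|k] /=; rewrite IH.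
Qed.

Theorem theorem4p7 (n : nat) (P : rel 'I_n)
    (hP : natural_unit_interval_order P)
    (c : partition_of n -> {poly int})
    (hc : is_e_expansion (chromatic_qsym (incomparable P)) c)
    (j : nat) :
  \sum_(la in Par n j) c la =
  \sum_(o in acyclic_orientations (incomparable P) j) 'X^(asc_orientation o).
Proof.
set G := incomparable P in hc *.
have symG : symmetric G by move=> x y; rewrite /G /incomparable eq_sym [~~ P x y && _]andbC.
(* With this [v], [1 - v] is the outer variable, whose exponent will record the number of parts or
   of sinks; the inner variable is t. *)
pose v : {poly {poly int}} := 1 - 'X.
pose lhs M := \sum_(la : partition_of n) (c la)%:P * \prod_(k <- parts la) esym_seq v k M.
pose rhs M := \sum_(o : {set 'I_n * 'I_n} | is_orientation G o && acyclic o)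
  ('X^(asc_orientation o))%:P *
  \sum_(S : {set 'I_n} | S \subset sinks o) v ^+ #|S| * strict_order_seq o _ (~: S) M.
have lhs_poly : poly_seq lhs.
  apply: poly_seq_sum => la _; apply: poly_seqM; first exact: poly_seq_const.
  by apply: poly_seq_prod => k /(allP (parts_gt0 la)); apply: esym_seq_poly.
have rhs_poly : poly_seq rhs.
  apply: poly_seq_sum => o /andP[_ ac_o]; apply: poly_seqM; first exact: poly_seq_const.
  apply: poly_seq_sum => S _; apply: poly_seqM; first exact: poly_seq_const.
  exact: strict_order_seq_poly.
(* For N >= 0 both sides are the evaluation of [chromatic_qsym G]: one through its e-expansion, the
   other through acyclic orientations. *)
have eqS N : lhs N.+1 = rhs N.+1.
  transitivity (fps_eval v n N (chromatic_qsym G)).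
    rewrite /fps_eval; under [RHS]eq_bigr do rewrite hc rmorph_sum mulr_suml.
    rewrite exchange_big; apply: eq_bigr => la _ /=.
    rewrite -(@fps_eval_prod_esym _ v n) ?parts_gt0 ?sumn_parts // /fps_eval mulr_sumr.
    by apply: eq_bigr => a _; rewrite polyCM mulrA.
  rewrite fps_eval_chromatic (sum_proper_coloring_orientations (fun k => ('X^k)%:P)) //.
  apply: eq_bigr => o _; rewrite sum_strict_maps; congr (_ * _).
  by apply: eq_bigr => S _; rewrite /= mulr_natr.
have eq0 := poly_seq_extrapolate lhs_poly rhs_poly eqS.
have v1 : 1 - v = 'X by rewrite /v opprB addrC subrK.
(* Each part [k] contributes [(-1) ^+ k * 'X], and the parts sum to [n]. *)
have lhs0 : lhs 0%N = (-1) ^+ n * \sum_(la : partition_of n) (c la)%:P * 'X^(size (parts la)).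
  rewrite mulr_sumr; apply: eq_bigr => la _; rewrite mulrCA; congr (_ * _).
  rewrite -[in (-1) ^+ n](sumn_parts la) /esym_seq v1.
  elim: (parts la) => [|k s IH]; first by rewrite big_nil mulr1.
  by rewrite big_cons IH /= exprD exprS mulrACA.
(* Reciprocity gives the sign (-1)^(n - |S|), so the sum over sets [S] of sinks is a signed subset
   sum. *)
have rhs0 : rhs 0%N = (-1) ^+ n *
    \sum_(o : {set 'I_n * 'I_n} | is_orientation G o && acyclic o)
      ('X^(asc_orientation o))%:P * 'X^(#|sinks o|).
  rewrite mulr_sumr; apply: eq_bigr => o _; rewrite mulrCA; congr (_ * _).
  rewrite -v1 -[in (-1) ^+ n](card_ord n) -cardsT -(sum_subset_signr _ (subsetT _)).
  by apply: eq_bigr => S _; rewrite setTD.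
(* The common sign is its own inverse, so multiplying by it cancels it; then the coefficients of
   ['X^j] in the outer variable are compared. *)
move: eq0; rewrite lhs0 rhs0 => /(congr1 ( *%R ((-1) ^+ n))).
rewrite !mulrA -!exprMn mulrNN mulr1 !expr1n !mul1r.
move/(congr1 (fun p : {poly {poly int}} => p`_j)); rewrite !coef_sum /=.
have coefj (x : {poly int}) k : (x%:P * 'X^k)`_j = if k == j then x else 0.
  by rewrite coefCM coefXn eq_sym; case: eqP; rewrite ?mulr1 ?mulr0.
under eq_bigr do rewrite coefj; under [in RHS]eq_bigr do rewrite coefj.
rewrite -!big_mkcond -big_mkcondr /= => E.
rewrite (eq_bigl (fun la => size (parts la) == j)); last by move=> la; rewrite inE.
rewrite E; apply: eq_bigl => o; by rewrite inE andbA.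
Qed.
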